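(* Let $M\geq2$ be an integer and let $K$ be uniformly distributed on $\{1,\ldots,M\}$. Let $Y=(Z,f_Z(K))$ follow the random probing model, i.e., $Z$ is a random state independent of $K$ and, for each value $z$ of $Z$, $f_z$ is a deterministic function on $\{1,\ldots,M\}$. Then for every real $\alpha>0$, $\alpha\neq1$: if $\alpha\geq\frac12$, $$1+\frac{M-1}{2}\,\frac{\exp\bigl(\frac{1-\alpha}{\alpha}H_\alpha(K|Y)\bigr)-1}{M^{(1-\alpha)/\alpha}-1}\;\geq\;G(K|Y)\;\geq\;\frac{1+\exp(H_\alpha(K|Y))}{2},$$ and if $\alpha\leq\frac12$, $$1+\frac{M-1}{2}\,\frac{\exp\bigl(\frac{1-\alpha}{\alpha}H_\alpha(K|Y)\bigr)-1}{M^{(1-\alpha)/\alpha}-1}\;\leq\;G(K|Y)\;\leq\;\frac{1+\exp(H_\alpha(K|Y))}{2}.$$ In the limiting case $\alpha=1$, $$\frac{1+\exp H(K|Y)}{2}\;\leq\;G(K|Y)\;\leq\;1+\frac{M-1}{2}\,\frac{H(K|Y)}{\log M}.$$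
   Context: $\log$ is the logarithm to a fixed base greater than $1$ and $\exp$ is its inverse function (e.g. natural logarithm and exponential). For a random variable $X$ with values in $\{1,\ldots,M\}$ and pmf $p_X$, the guessing entropy is $G(X)=\min_\sigma\sum_{i=1}^M p_X(\sigma(i))\,i$, the minimum being over all permutations $\sigma$ of $\{1,\ldots,M\}$. For a random variable $Y$, with $p_{X|Y=y}$ the conditional pmf of $X$ given $Y=y$: $G(X|Y)=\mathbb{E}_y G(X|Y=y)$, where $G(X|Y=y)$ is the guessing entropy of $p_{X|Y=y}$; for $\alpha\neq1$ the conditional R\'enyi-Arimoto entropy is $H_\alpha(X|Y)=-\frac{\alpha}{\alpha-1}\log\mathbb{E}_Y\|p_{X|Y}\|_\alpha$ with $\|p\|_\alpha=(\sum_i p(i)^\alpha)^{1/\alpha}$; and $H(X|Y)=\mathbb{E}_y\bigl[-\sum_i p_{X|Y=y}(i)\log p_{X|Y=y}(i)\bigr]$ is the conditional Shannon entropy. *)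

(* Defs.v *)
From HB Require Import structures.
From mathcomp Require Import all_boot all_order all_algebra all_fingroup.
From mathcomp Require Import all_classical all_reals all_analysis.
Set Implicit Arguments.
Unset Strict Implicit.
Unset Printing Implicit Defensive.
Import Order.TTheory GRing.Theory Num.Theory.
Import numFieldNormedType.Exports.
Local Open Scope classical_set_scope.
Local Open Scope ring_scope.

Section log_exp.
Variables (R : realType) (b : R).

Definition logb (x : R) : R := ln x / ln b.

Definition expb (x : R) : R := b `^ x.

End log_exp.

Section pmf_functionals.
Variables (R : realType) (M : nat).
Implicit Type p : 'I_M -> R.

(* {1, ..., M} is represented by 'I_M, so the element i has rank i.+1. *)
Definition mean_rank p (s : 'S_M) : R := \sum_(i < M) p (s i) * i.+1%:R.

(* The bigop default [mean_rank p 1] is one of the values over which the minimum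
   is taken, so it does not change the minimum. *)
Definition guessing_entropy p : R :=
  \big[Num.min/mean_rank p 1%g]_(s : 'S_M) mean_rank p s.

Definition alpha_norm (a : R) p : R := (\sum_(i < M) p i `^ a) `^ a^-1.

(* [ln 0 = 0] implements the convention 0 log 0 = 0. *)
Definition shannon_entropy (b : R) p : R := - \sum_(i < M) p i * logb b (p i).

End pmf_functionals.

Section random_variables.
Variables (R : realType) (d : measure_display) (T : measurableType d).
Variable P : probability T R.

Section finite_valued.
Variable M : nat.

(* 'I_M (possibly empty for a variable M) is not a measurableType in the library,
   so an 'I_M-valued random variable is a plain function that is measurable for
   the discrete sigma-algebra on 'I_M. *)
Definition discrete_RV (X : T -> 'I_M) : Prop :=
  forall B : set 'I_M, measurable (X @^-1` B).

Definition uniform_RV (X : T -> 'I_M) : Prop :=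
  forall i : 'I_M, P (X @^-1` [set i]) = (M%:R^-1)%:E.

Definition independent_RVs (d' : measure_display) (W : measurableType d')
    (Z : {RV P >-> W}) (X : T -> 'I_M) : Prop :=
  forall (A : set W) (B : set 'I_M), measurable A ->
    P (Z @^-1` A `&` X @^-1` B) = (P (Z @^-1` A) * P (X @^-1` B))%E.

End finite_valued.

Section conditioning.
Variables (M : nat) (X : T -> 'I_M).
Variables (d' : measure_display) (W : measurableType d') (Y : {RV P >-> W}).

(* [p y] is the conditional pmf of X given Y = y: p is a (regular) version of
   the conditional distribution.  Y need not be discrete, so p is determined
   only up to a null set of the law of Y; this does not affect the expectations
   below. *)
Record conditional_pmf (p : W -> 'I_M -> R) : Prop := ConditionalPmf {
  cpmf_measurable : forall i, measurable_fun setT (p^~ i) ;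
  cpmf_ge0 : forall y i, 0 <= p y i ;
  cpmf_sum1 : forall y, \sum_(i < M) p y i = 1 ;
  cpmf_joint : forall (i : 'I_M) (B : set W), measurable B ->
    P (X @^-1` [set i] `&` Y @^-1` B) =
    (\int[distribution P Y]_(y in B) (p y i)%:E)%E }.

(* The integrands below are bounded, hence [fine] only changes the type. *)
Definition cond_guessing_entropy (p : W -> 'I_M -> R) : R :=
  fine 'E_(distribution P Y)[fun y => guessing_entropy (p y)].

Definition cond_renyi_arimoto_entropy (b a : R) (p : W -> 'I_M -> R) : R :=
  - (a / (a - 1)) *
    logb b (fine 'E_(distribution P Y)[fun y => alpha_norm a (p y)]).

Definition cond_shannon_entropy (b : R) (p : W -> 'I_M -> R) : R :=
  fine 'E_(distribution P Y)[fun y => shannon_entropy b (p y)].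

End conditioning.
End random_variables.

(* Main.v *)
Require Import Defs.
From HB Require Import structures.
From mathcomp Require Import all_boot all_order all_algebra all_fingroup.
From mathcomp Require Import all_classical all_reals all_analysis.
From mathcomp Require Import measurable_realfun ring lra.
Set Implicit Arguments.
Unset Strict Implicit.
Unset Printing Implicit Defensive.
Import Order.TTheory GRing.Theory Num.Theory.
Import numFieldNormedType.Exports.
Local Open Scope classical_set_scope.
Local Open Scope ring_scope.

(* Given Y, the posterior pmf of K is almost surely uniform on a set of random
   size N between 1 and M.  Hence G = E[(1 + N) / 2], the alpha-norm is N ^ s with
   s = (1 - alpha) / alpha, and the Shannon entropy is log N.  All bounds then
   express the concavity (s <= 1) or convexity (1 <= s) of
   phi_s x = (x ^ s - 1) / s, with phi_0 = ln: Jensen's inequality gives the bounds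
   with (1 + exp H) / 2, and the chord of phi_s over [1, M] gives the others. *)

(** * Tangent lines and monotonicity of the Box-Cox functions *)

Section box_cox.
Context {R : realType}.
Implicit Types s x y m : R.

(* [ln] is the limit of [(x `^ s - 1) / s] as [s] tends to 0. *)
Definition box_cox s x : R := if s == 0 then ln x else (x `^ s - 1) / s.

Lemma box_coxE s x : s != 0 -> box_cox s x = (x `^ s - 1) / s.
Proof. by rewrite /box_cox => /negbTE ->. Qed.

Lemma box_cox1 s : box_cox s 1 = 0.
Proof. by rewrite /box_cox ln1 powR1 subrr mul0r if_same. Qed.

(** With [t = ln x], everything follows from [1 + y <= expR y]. For [s < 0] it is used at [t] and
    [s * t]. For [0 < s] the inequality reads [x ^ s <= s * x + (1 - s)], a weighted AM-GM. *)
Lemma box_cox_le s x : s <= 1 -> 0 < x -> box_cox s x <= x - 1.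
Proof.
move=> s1 x0; rewrite /box_cox; case: eqVneq => [_|sN0].
  by have := expR_ge1Dx (ln x); rewrite lnK// -lerBrDl.
rewrite /powR gt_eqF//; set t := ln x; have xE : x = expR t by rewrite lnK.
have [s0|] := ltP s 0.
  rewrite ler_ndivrMr// xE.
  by have := expR_ge1Dx (s * t); have := expR_ge1Dx t; nra.
rewrite le_eqVlt eq_sym (negbTE sN0)/= => s0.
rewrite ler_pdivrMr//.
(* [x] and [1] are written as multiples of [u = expR (s * t)]; bounding the cofactors and adding
   with weights [s] and [1 - s] cancels the terms in [t]. *)
have E1 : x = expR (s * t) * expR ((1 - s) * t).
  by rewrite -expRD -mulrDl addrC subrK mul1r.
have E2 : 1 = expR (s * t) * expR (- (s * t)) by rewrite -expRD subrr expR0.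
have u0 : 0 < expR (s * t) by exact: expR_gt0.
have h1 := ler_wpM2l (ltW u0) (expR_ge1Dx ((1 - s) * t)).
have h2 := ler_wpM2l (ltW u0) (expR_ge1Dx (- (s * t))).
rewrite -E1 in h1; rewrite -E2 in h2.
have := ler_wpM2l (ltW s0) h1.
have s1' : 0 <= 1 - s by rewrite subr_ge0.
have := ler_wpM2l s1' h2.
move: (expR _) => u; lra.
Qed.

(** This is Bernoulli's inequality [1 + s * (x - 1) <= x ^ s]. The common factor is now [u = x], and
    the weights are [1] and [s - 1]. *)
Lemma box_cox_ge s x : 1 <= s -> 0 < x -> x - 1 <= box_cox s x.
Proof.
move=> s1 x0; have s0 : 0 < s by rewrite (lt_le_trans _ s1).
rewrite box_coxE ?gt_eqF// ler_pdivlMr// /powR gt_eqF//.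
set t := ln x; have xE : x = expR t by rewrite lnK.
have E1 : expR (s * t) = expR t * expR ((s - 1) * t).
  by rewrite -expRD mulrBl mul1r addrC subrK.
have E2 : 1 = expR t * expR (- t) by rewrite -expRD subrr expR0.
have u0 : 0 < expR t by exact: expR_gt0.
have h1 := ler_wpM2l (ltW u0) (expR_ge1Dx ((s - 1) * t)).
have h2 := ler_wpM2l (ltW u0) (expR_ge1Dx (- t)).
rewrite -E1 in h1; rewrite -E2 in h2.
have s1' : 0 <= s - 1 by rewrite subr_ge0.
have := ler_wpM2l s1' h2.
rewrite xE; move: (expR _) (expR _) h1 => u v; lra.
Qed.

(** Rescaling by [m] carries the tangent at [1] to the tangent at [m]. *)
Lemma box_coxB s x m : 0 < x -> 0 < m ->
  box_cox s x - box_cox s m = m `^ s * box_cox s (x / m).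
Proof.
move=> x0 m0; rewrite /box_cox; case: eqVneq => [->|sN0].
  by rewrite powRr0 mul1r ln_div.
have -> : x `^ s = m `^ s * (x / m) `^ s.
  by rewrite -powRM ?divr_ge0 ?ltW// mulrCA divff ?mulr1// gt_eqF.
by field.
Qed.

(* These two inequalities make [box_cox s] concave for [s <= 1] and convex for
   [1 <= s]. *)
Lemma box_cox_le_tangent s x m : s <= 1 -> 0 < x -> 0 < m ->
  box_cox s x <= box_cox s m + m `^ s / m * (x - m).
Proof.
move=> s1 x0 m0; rewrite -lerBlDl box_coxB// -mulrA ler_wpM2l ?powR_ge0//.
apply: le_trans (box_cox_le s1 _) _; first exact: divr_gt0.
by rewrite mulrBr mulVf ?gt_eqF// mulrC.
Qed.

Lemma box_cox_ge_tangent s x m : 1 <= s -> 0 < x -> 0 < m ->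
  box_cox s m + m `^ s / m * (x - m) <= box_cox s x.
Proof.
move=> s1 x0 m0; rewrite -lerBrDl box_coxB// -mulrA ler_wpM2l ?powR_ge0//.
apply: le_trans (box_cox_ge s1 _); last exact: divr_gt0.
by rewrite mulrBr mulVf ?gt_eqF// mulrC.
Qed.

(** Every tangent has positive slope: for [s <= 1] the tangent at [x] is compared at [y], otherwise
    the tangent at [y] is compared at [x]. *)
Lemma box_cox_le_inv s x y : 0 < x -> 0 < y ->
  box_cox s x <= box_cox s y -> x <= y.
Proof.
move=> x0 y0 xy; have [s1|s1] := leP s 1.
  have := le_trans xy (box_cox_le_tangent s1 y0 x0).
  by rewrite lerDl pmulr_rge0 ?divr_gt0 ?powR_gt0// subr_ge0.
have := le_trans (box_cox_ge_tangent (ltW s1) x0 y0) xy.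
by rewrite gerDl pmulr_rle0 ?divr_gt0 ?powR_gt0// subr_le0.
Qed.

Lemma box_cox_powR_inv s x : s != 0 -> 0 < x ->
  box_cox s (x `^ s^-1) = (x - 1) / s.
Proof.
by move=> s0 x0; rewrite box_coxE// -powRrM mulVf// powRr1// ltW.
Qed.

Lemma box_cox_gt0 s x : 1 < x -> 0 < box_cox s x.
Proof.
move=> x1; have x0 : 0 < x by apply: lt_trans x1.
rewrite ltNge -(box_cox1 s); apply/negP => /(box_cox_le_inv x0 ltr01).
by rewrite leNgt x1.
Qed.

End box_cox.

(** * Jensen and chord inequalities for finite weighted sums *)

Section jensen.
Context {R : realType} {I : finType}.
Variables (q x : I -> R).
Hypotheses (q_ge0 : forall i, 0 <= q i) (q_sum1 : \sum_i q i = 1).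

Lemma sum_affine (c e : R) (h : I -> R) :
  \sum_i q i * (c + e * h i) = c + e * \sum_i q i * h i.
Proof.
under eq_bigr do rewrite mulrDr mulrCA.
by rewrite big_split/= -mulr_suml q_sum1 mul1r mulr_sumr.
Qed.

Section concave.
Variable phi : R -> R.
Hypothesis phi_supergradient : forall m, 0 < m ->
  exists c, forall y, 0 < y -> phi y <= phi m + c * (y - m).

(** Averaging the supergradient inequality at the mean [m] kills its linear term. Only indices of
    nonzero weight have [x i] constrained, hence the case splits on [q i]. *)
Lemma jensen_supergradient : (forall i, q i != 0 -> 0 < x i) ->
  \sum_i q i * phi (x i) <= phi (\sum_i q i * x i).
Proof.
move=> x0; set m := \sum_i _ * x i.
have m0 : 0 < m.
  have [i qi] : exists i, q i != 0.
    apply: contrapT => qz.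
    move: q_sum1; rewrite big1 => [/esym/eqP|i _]; first by rewrite oner_eq0.
    by apply: contrapT => /eqP qi; apply: qz; exists i.
  apply: (@lt_le_trans _ _ (q i * x i)).
    by rewrite mulr_gt0 ?x0// lt_def qi q_ge0.
  rewrite /m (bigD1 i)//= lerDl sumr_ge0// => j _.
  have [->|qj] := eqVneq (q j) 0; first by rewrite mul0r.
  by rewrite mulr_ge0// ltW// x0.
have [c cP] := phi_supergradient m0.
have -> : phi m = \sum_i q i * ((phi m - c * m) + c * x i).
  by rewrite sum_affine subrK.
apply: ler_sum => i _; have [->|qi] := eqVneq (q i) 0; first by rewrite !mul0r.
by rewrite ler_wpM2l// (le_trans (cP _ (x0 _ qi)))// mulrBr addrAC addrA.
Qed.

(** The supergradient inequality at [y], evaluated at [1] and at [b] with weights [b - y] and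
    [y - 1], eliminates the unknown slope [c]. *)
Lemma chord_supergradient (b y : R) : phi 1 = 0 -> 1 <= y -> y <= b ->
  (y - 1) * phi b <= (b - 1) * phi y.
Proof.
move=> phi1 y1 yb; have y0 : 0 < y by apply: lt_le_trans y1.
have [c cP] := phi_supergradient y0.
have := cP _ ltr01; have := cP b (lt_le_trans y0 yb); rewrite phi1.
nra.
Qed.

Lemma mean_chord_supergradient (b : R) : phi 1 = 0 ->
  (forall i, q i != 0 -> 1 <= x i <= b) ->
  (\sum_i q i * x i - 1) * phi b <= (b - 1) * \sum_i q i * phi (x i).
Proof.
move=> phi1 xP.
have -> : \sum_i q i * x i - 1 = \sum_i q i * (x i - 1).
  under [RHS]eq_bigr do rewrite addrC -[x _]mul1r.
  by rewrite sum_affine mul1r addrC.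
rewrite mulr_suml mulr_sumr; apply: ler_sum => i _.
have [->|/xP /andP[x1 xb]] := eqVneq (q i) 0; first by rewrite !mul0r mulr0.
by rewrite -mulrA [leRHS]mulrCA ler_wpM2l// chord_supergradient.
Qed.

End concave.
End jensen.

(** * Power means and the geometric mean of values in [[1, N]] *)

Section power_mean.
Context {R : realType} {I : finType}.
Variables (q x : I -> R) (N : R).
Hypotheses (q_ge0 : forall i, 0 <= q i) (q_sum1 : \sum_i q i = 1).
Hypotheses (N_gt1 : 1 < N) (x_itv : forall i, q i != 0 -> 1 <= x i <= N).

Let m := \sum_i q i * x i.

Let x_gt0 i : q i != 0 -> 0 < x i.
Proof. by move=> /x_itv /andP[x1 _]; apply: lt_le_trans x1. Qed.

Let mean_ge1 (h : I -> R) : (forall i, q i != 0 -> 1 <= h i) ->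
  1 <= \sum_i q i * h i.
Proof.
move=> h1; rewrite -[leLHS]q_sum1; apply: ler_sum => i _.
have [->|/h1 hi] := eqVneq (q i) 0; first by rewrite mul0r.
by rewrite -[leLHS]mulr1 ler_wpM2l.
Qed.

Lemma mean_powR_gt0 s : 0 < \sum_i q i * x i `^ s.
Proof.
have N0 : 0 < N by apply: lt_trans N_gt1.
(* On [[1, N]] the power [x ^ s] is at least [1] if [0 <= s] and at least [N ^ s] if [s < 0]. *)
pose e : R := Num.min 1 (N `^ s).
have e0 : 0 < e by rewrite lt_min ltr01 powR_gt0.
apply: (lt_le_trans e0).
rewrite -[leLHS]mulr1 -q_sum1 mulr_sumr; apply: ler_sum => i _.
have [->|/x_itv /andP[x1 xN]] := eqVneq (q i) 0; first by rewrite mulr0 mul0r.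
rewrite mulrC ler_wpM2l// /e; have [s0|s0] := leP 0 s.
  by rewrite ge_min -(powRr0 (x i)) ler_powR.
rewrite ge_min; apply/orP; right.
have x0 : 0 < x i by apply: lt_le_trans x1.
rewrite -[s]opprK !(powRN _ (- s)) lef_pV2 ?posrE ?powR_gt0//.
by apply: ge0_ler_powR; rewrite ?nnegrE ?oppr_ge0// ltW.
Qed.

Lemma mean_box_cox s : s != 0 ->
  \sum_i q i * box_cox s (x i) = (\sum_i q i * x i `^ s - 1) / s.
Proof.
move=> s0; transitivity (\sum_i q i * (- s^-1 + s^-1 * x i `^ s)).
  by apply: eq_bigr => i _; rewrite box_coxE//; congr (_ * _); field.
by rewrite sum_affine//; field.
Qed.

Lemma mean_box_cox_le s : s <= 1 ->
  \sum_i q i * box_cox s (x i) <= box_cox s m /\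
  m - 1 <= (N - 1) * ((\sum_i q i * box_cox s (x i)) / box_cox s N).
Proof.
move=> s1; have tangent y : 0 < y -> exists c, forall z, 0 < z ->
    box_cox s z <= box_cox s y + c * (z - y).
  by move=> y0; exists (y `^ s / y) => z z0; exact: box_cox_le_tangent.
split; first by apply: jensen_supergradient.
rewrite mulrA ler_pdivlMr ?box_cox_gt0//.
by apply: mean_chord_supergradient => //; exact: box_cox1.
Qed.

(** The concave case is applied to [- box_cox s]. *)
Lemma mean_box_cox_ge s : 1 <= s ->
  box_cox s m <= \sum_i q i * box_cox s (x i) /\
  (N - 1) * ((\sum_i q i * box_cox s (x i)) / box_cox s N) <= m - 1.
Proof.
move=> s1; have tangent y : 0 < y -> exists c, forall z, 0 < z ->
    - box_cox s z <= - box_cox s y + c * (z - y).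
  move=> y0; exists (- (y `^ s / y)) => z z0.
  by rewrite mulNr -opprD lerN2; exact: box_cox_ge_tangent.
have sumN : \sum_i q i * - box_cox s (x i) = - \sum_i q i * box_cox s (x i).
  by rewrite -sumrN; apply: eq_bigr => i _; rewrite mulrN.
split.
  rewrite -lerN2 -sumN.
  exact: (jensen_supergradient q_ge0 q_sum1 (phi := fun z => - box_cox s z)).
rewrite mulrA ler_pdivrMr ?box_cox_gt0// -lerN2 -!mulrN -sumN.
apply: (mean_chord_supergradient q_ge0 q_sum1 (phi := fun z => - box_cox s z)) => //.
by rewrite box_cox1 oppr0.
Qed.

(** The factors [1 / s] cancel, so the chord bound has the same form for both signs of [s]. *)
Let box_cox_ratio s (A : R) : s != 0 ->
  (A - 1) / s / box_cox s N = (A - 1) / (N `^ s - 1).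
Proof.
move=> s0; have := box_cox_gt0 s N_gt1; rewrite box_coxE// => h.
have Ns : N `^ s - 1 != 0 by apply: contraTneq h => ->; rewrite mul0r ltxx.
by field; apply/andP.
Qed.

(** [box_cox s] of the power mean is the mean of [box_cox s], so Jensen becomes a comparison of
    [box_cox] values, which [box_cox_le_inv] undoes. *)
Lemma power_mean_le s : s != 0 -> s <= 1 ->
  (\sum_i q i * x i `^ s) `^ s^-1 <= m /\
  m - 1 <= (N - 1) * ((\sum_i q i * x i `^ s - 1) / (N `^ s - 1)).
Proof.
move=> s0 /mean_box_cox_le; rewrite mean_box_cox// box_cox_ratio// => -[h ?].
split=> //; apply: (@box_cox_le_inv _ s); first exact/powR_gt0/mean_powR_gt0.
  by rewrite (lt_le_trans ltr01)// mean_ge1// => i /x_itv /andP[].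
by rewrite box_cox_powR_inv// mean_powR_gt0.
Qed.

Lemma power_mean_ge s : s != 0 -> 1 <= s ->
  m <= (\sum_i q i * x i `^ s) `^ s^-1 /\
  (N - 1) * ((\sum_i q i * x i `^ s - 1) / (N `^ s - 1)) <= m - 1.
Proof.
move=> s0 /mean_box_cox_ge; rewrite mean_box_cox// box_cox_ratio// => -[h ?].
split=> //; apply: (@box_cox_le_inv _ s); last 1 first.
- by rewrite box_cox_powR_inv// mean_powR_gt0.
- by rewrite (lt_le_trans ltr01)// mean_ge1// => i /x_itv /andP[].
- exact/powR_gt0/mean_powR_gt0.
Qed.

Lemma geometric_mean_le :
  expR (\sum_i q i * ln (x i)) <= m /\
  m - 1 <= (N - 1) * ((\sum_i q i * ln (x i)) / ln N).
Proof.
have := mean_box_cox_le ler01; rewrite /box_cox eqxx => -[h ?]; split => //.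
rewrite -[leRHS]lnK ?ler_expR// posrE (lt_le_trans ltr01)// mean_ge1// => i.
by move=> /x_itv /andP[].
Qed.

End power_mean.

(** * Entropies of a uniform pmf on a subset *)

Section uniform_on.
Context {R : realType} {M : nat}.
Implicit Types S : {set 'I_M}.

Definition uniform_on S (i : 'I_M) : R := (i \in S)%:R / #|S|%:R.

Lemma sum_uniform_on S (g : R -> R) : g 0 = 0 ->
  \sum_(i < M) g (uniform_on S i) = #|S|%:R * g #|S|%:R^-1.
Proof.
move=> g0; rewrite (bigID (mem S))/= addrC big1 => [|i /negbTE iS].
  rewrite add0r (eq_bigr (fun=> g #|S|%:R^-1)) => [|i iS].
    by rewrite sumr_const mulr_natl.
  by rewrite /uniform_on iS mul1r.
by rewrite /uniform_on iS mul0r.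
Qed.

Lemma sum_ord_lt_mul n (g : nat -> R) : (n <= M)%N ->
  \sum_(i < M) (i < n)%N%:R * g i = \sum_(i < n) g i.
Proof.
move=> nM; rewrite [RHS](big_ord_widen _ _ nM) [RHS]big_mkcond/=.
by apply: eq_bigr => i _; case: ltnP; rewrite ?mul1r ?mul0r.
Qed.

Lemma sum_ranks n : \sum_(i < n) i.+1%:R = (n%:R * (1 + n%:R)) / 2 :> R.
Proof.
elim: n => [|n IH]; first by rewrite big_ord0 !mul0r.
by rewrite big_ord_recr/= IH -natr1; field.
Qed.

Lemma sum_mem_natr S : \sum_(i < M) (i \in S)%:R = #|S|%:R :> R.
Proof.
rewrite -sum1_card natr_sum [RHS]big_mkcond/=.
by apply: eq_bigr => i _; case: (i \in S).
Qed.

Lemma sum_ranks_ge S :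
  (#|S|%:R * (1 + #|S|%:R)) / 2 <= \sum_(i < M) (i \in S)%:R * i.+1%:R :> R.
Proof.
have nM : (#|S| <= M)%N by rewrite -[leqRHS]card_ord max_card.
rewrite -sum_ranks -(sum_ord_lt_mul (fun i => i.+1%:R) nM).
set n := #|S| in nM *.
have cS : \sum_(i < M) (i \in S)%:R = n%:R :> R.
  exact: sum_mem_natr.
have cn : \sum_(i < M) (i < n)%N%:R = n%:R :> R.
  under eq_bigr do rewrite -[_%:R]mulr1.
  by rewrite (sum_ord_lt_mul (fun=> 1) nM) sumr_const card_ord.
(* Both sets have n elements, so subtracting the rank n + 1 of the first point
   outside the initial segment changes nothing and makes every term >= 0. *)
rewrite -subr_ge0 -sumrB.
have -> : \sum_(i < M) ((i \in S)%:R * i.+1%:R - (i < n)%N%:R * i.+1%:R) =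
  \sum_(i < M) ((i \in S)%:R - (i < n)%N%:R) * (i.+1%:R - n.+1%:R) :> R.
  under [RHS]eq_bigr do rewrite mulrBr mulrBl.
  rewrite [RHS]sumrB -[X in _ = _ - X]mulr_suml [X in _ = _ - X * _]sumrB.
  by rewrite cS cn subrr mul0r subr0.
apply: sumr_ge0 => i _; case: ltnP => ni.
  have : i.+1%:R <= n.+1%:R :> R by rewrite ler_nat ltnS ltnW.
  case: (_ \in _) => /=; nra.
have : n.+1%:R <= i.+1%:R :> R by rewrite ler_nat ltnS.
case: (_ \in _) => /=; nra.
Qed.

(** This is an optimal guessing order: all of [S] first, then its complement. *)
Lemma exists_perm_initial S :
  exists s : 'S_M, forall i : 'I_M, (s i \in S) = (i < #|S|)%N.
Proof.
pose t := enum S ++ enum (~: S).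
have st : size t = M by rewrite size_cat -!cardE cardsC card_ord.
have ut : uniq t.
  rewrite cat_uniq !enum_uniq andbT/=; apply/hasPn => i.
  by rewrite !mem_enum inE.
(* [t] has size [M], so the default [i] of [nth] is never returned. *)
have inj : injective (fun i : 'I_M => nth i t i).
  move=> i j; rewrite (set_nth_default j i) ?st ?ltn_ord// => /eqP.
  by rewrite nth_uniq ?st ?ltn_ord// => /eqP/val_inj.
exists (perm inj) => i; rewrite permE nth_cat -cardE; case: ltnP => iS.
  by rewrite -mem_enum mem_nth// -cardE.
apply/negbTE; rewrite -finset.in_setC -mem_enum mem_nth// -cardE.
by rewrite ltn_subLR// cardsC card_ord.
Qed.

(** The preimage of [S] is the set of positions at which [s] guesses an element of [S]. *)
Lemma mean_rank_uniform_on S (s : 'S_M) : mean_rank (uniform_on S) s =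
  (\sum_(i < M) (i \in (s @^-1: S))%:R * i.+1%:R) / #|S|%:R.
Proof.
rewrite /mean_rank mulr_suml; apply: eq_bigr => i _.
by rewrite /uniform_on inE mulrAC.
Qed.

(** The preimage of [S] under a permutation has the size of [S], so [sum_ranks_ge] bounds every
    order from below; guessing [S] first attains the bound. *)
Lemma guessing_entropy_uniform_on S : S != finset.set0 ->
  guessing_entropy (uniform_on S) = (1 + #|S|%:R) / 2.
Proof.
move=> S0; have n0 : 0 < #|S|%:R :> R by rewrite ltr0n card_gt0.
have nM : (#|S| <= M)%N by rewrite -[leqRHS]card_ord max_card.
have lb (s : 'S_M) : (1 + #|S|%:R) / 2 <= mean_rank (uniform_on S) s.
  rewrite mean_rank_uniform_on ler_pdivlMr// mulrC mulrA.
  have <- : #|s @^-1: S| = #|S| by exact/card_preimset/perm_inj.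
  exact: sum_ranks_ge.
apply/eqP; rewrite eq_le; apply/andP; split; last first.
  rewrite /guessing_entropy; elim/big_ind : _ => // x y ? ?.
  by rewrite le_min; apply/andP.
have [s sP] := exists_perm_initial S.
apply: (@le_trans _ _ (mean_rank (uniform_on S) s)).
  by rewrite /guessing_entropy; apply: bigmin_le_cond.
rewrite mean_rank_uniform_on.
under eq_bigr do rewrite inE sP.
rewrite (sum_ord_lt_mul (fun i => i.+1%:R) nM) sum_ranks.
by rewrite mulrAC mulrAC mulrC mulrA mulrA mulVf ?gt_eqF// mul1r.
Qed.

(** With [n = #|S|], the powers sum to [n * n ^ (- a) = n ^ (1 - a)]. Points outside [S] add nothing
    because [a != 0] gives [0 ^ a = 0]. *)
Lemma alpha_norm_uniform_on a S : 0 < a -> S != finset.set0 ->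
  alpha_norm a (uniform_on S) = #|S|%:R `^ ((1 - a) / a).
Proof.
move=> a0 S0; have n0 : 0 < #|S|%:R :> R by rewrite ltr0n card_gt0.
rewrite /alpha_norm (sum_uniform_on S (g := fun x => x `^ a)); last first.
  by rewrite powR0// gt_eqF.
rewrite -powR_inv1 ?ltW// -powRrM mulN1r -[X in X * _]powRr1 ?ltW//.
by rewrite -powRD ?(gt_eqF n0) ?implybT// -powRrM.
Qed.

Lemma shannon_entropy_uniform_on b S : S != finset.set0 ->
  shannon_entropy b (uniform_on S) = ln #|S|%:R / ln b.
Proof.
move=> S0; have n0 : 0 < #|S|%:R :> R by rewrite ltr0n card_gt0.
rewrite /shannon_entropy (sum_uniform_on S (g := fun x => x * logb b x)) ?mul0r//.
by rewrite mulrA divff ?gt_eqF// mul1r /logb lnV ?posrE// mulNr opprK.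
Qed.

(** Any two positive values coincide, and normalisation fixes their common value. The last
    hypothesis fails exactly on the events shown null in [cpmf_lt_null]. *)
Lemma pmf_uniform_on (p : 'I_M -> R) : (forall i, 0 <= p i) ->
  \sum_(i < M) p i = 1 -> (forall i j, 0 < p j -> ~ p j < p i) ->
  p = uniform_on [set i | 0 < p i]%SET /\ [set i | 0 < p i]%SET != finset.set0.
Proof.
move=> p0 p1 ple; set S := [set i | _]%SET.
have S0 : S != finset.set0.
  apply/negP => /eqP S0; move: p1; rewrite big1 => [/esym/eqP|i _].
    by rewrite oner_eq0.
  apply/eqP; rewrite eq_le p0 andbT leNgt; apply/negP => pi0.
  by have := finset.in_set0 i; rewrite -S0 inE pi0.
split => //; have [i0] := set0Pn _ S0; rewrite inE => pi0.
have pE i : p i = (i \in S)%:R * p i0.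
  rewrite inE; have [pi|pi] := ltP 0 (p i).
    rewrite mul1r; apply/eqP; rewrite eq_le.
    by rewrite !leNgt; apply/andP; split; apply/negP; exact: ple.
  by rewrite mul0r; apply/eqP; rewrite eq_le pi p0.
have n0 : 0 < #|S|%:R :> R by rewrite ltr0n card_gt0.
have : #|S|%:R * p i0 = 1.
  rewrite -[RHS]p1 -sum_mem_natr mulr_suml.
  by apply: eq_bigr => i _; rewrite -pE.
move=> /(congr1 (fun z => #|S|%:R^-1 * z)).
rewrite mulrA mulVf ?gt_eqF// mul1r mulr1 => pi0E.
by apply/funext => i; rewrite /uniform_on -pi0E -pE.
Qed.

End uniform_on.

(** * Expectations as finite sums, and criteria for null sets *)

Section measure_facts.
Context d {T : measurableType d} {R : realType}.

(** [X] is almost everywhere a combination of indicators of the fibres of [s], which is integrated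
    term by term. *)
Lemma expectation_fin_comp (mu : probability T R) (I : finType) (s : T -> I)
    (X : T -> R) (c : I -> R) : (forall i, measurable (s @^-1` [set i])) ->
  measurable_fun setT X -> {ae mu, forall y, X y = c (s y)} ->
  fine 'E_mu[X] = \sum_i fine (mu (s @^-1` [set i])) * c i.
Proof.
move=> ms mX Xc; pose A i := s @^-1` [set i].
have cE y : c (s y) = \sum_i c i * \1_(A i) y.
  rewrite (bigD1 (s y))//= indicE mem_set//= mulr1 big1 ?addr0// => i iy.
  by rewrite indicE memNset ?mulr0// /A/= => si; rewrite si eqxx in iy.
have intA i : mu.-integrable setT (EFin \o \1_(A i)).
  by apply: integrable_indic; exact: ms.
rewrite unlock (ae_eq_integral (fun y => (\sum_i (c i)%:E * (\1_(A i) y)%:E)%E))//=.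
- rewrite integral_sum//; last by move=> i; exact: (integrableZl measurableT _ (intA i)).
  rewrite -sum_fine => [|i _]; last first.
    by apply: integrable_fin_num => //; exact: (integrableZl measurableT _ (intA i)).
  apply: eq_bigr => i _.
  rewrite (integralZl measurableT (intA i)).
  rewrite (integral_indic _ measurableT (ms i)).
  by rewrite setIT fineM ?fin_num_measure//= mulrC.
- exact/measurable_EFinP.
- apply: emeasurable_sum => i; apply: emeasurable_funM => //.
  by apply/measurable_EFinP; apply: measurable_indic; exact: ms.
- apply: filterS Xc => y Xc _; rewrite Xc cE -sumEFin.
  by apply: eq_bigr => i _; rewrite EFinM.
Qed.

Lemma ge0_integral0_null (mu : {measure set T -> \bar R}) (A : set T)
    (f : T -> \bar R) : measurable A -> measurable_fun A f ->
  (forall x, A x -> 0 < f x)%E -> (\int[mu]_(x in A) f x = 0)%E -> mu A = 0%E.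
Proof.
move=> mA mf f0 int0.
have : (\int[mu]_(x in A) `|f x| = 0)%E.
  rewrite -int0; apply: eq_integral => x /set_mem/f0 fx.
  by rewrite gee0_abs// ltW.
move=> /(ae_eq_integral_abs mu mA mf)[N [mN N0 AN]].
apply: (subset_measure0 mA mN _ N0) => x Ax; apply: AN => /= /(_ Ax) fx0.
by have := f0 x Ax; rewrite fx0 ltxx.
Qed.

(** On [A] one has [f < g <= 1], so the integral of [f] is finite and can be cancelled. Then
    [g - f], positive on [A], has integral zero there. *)
Lemma integral_le_lt_null (mu : probability T R) (A : set T)
    (f g : T -> R) : measurable A ->
  measurable_fun setT f -> measurable_fun setT g ->
  (forall x, 0 <= f x) -> (forall x, g x <= 1) ->
  (forall x, A x -> f x < g x) ->
  (\int[mu]_(x in A) (g x)%:E <= \int[mu]_(x in A) (f x)%:E)%E -> mu A = 0%E.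
Proof.
move=> mA mf mg f0 g1 fg.
have mfA := measurable_funTS (D := A) mf.
have mgA := measurable_funTS (D := A) mg.
rewrite (eq_integral (fun x => (f x)%:E + (g x - f x)%:E)%E); last first.
  by move=> x _; rewrite -EFinD addrC subrK.
rewrite ge0_integralD//=.
- have f1 x : A x -> f x <= 1 by move=> /fg/ltW/le_trans; apply.
  have ffin : (\int[mu]_(x in A) (f x)%:E)%E \is a fin_num.
    rewrite ge0_fin_numE ?integral_ge0//; last by move=> x _; rewrite lee_fin.
    apply: (@le_lt_trans _ _ (\int[mu]_(x in A) (cst 1) x)%E).
      apply: ge0_le_integral => //.
      + by move=> x _; rewrite lee_fin.
      + exact/measurable_EFinP.
    by rewrite (integral_cst mu mA) mul1e -ge0_fin_numE// fin_num_measure.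
  rewrite -[leRHS]adde0 leeD2lE// => le0.
  apply: (@ge0_integral0_null mu A (fun x => (g x - f x)%:E)) => //.
  + by apply/measurable_EFinP; exact: measurable_funB.
  + by move=> x Ax; rewrite lte_fin subr_gt0 fg.
  + apply/eqP; rewrite eq_le le0/= integral_ge0// => x Ax.
    by rewrite lee_fin subr_ge0 ltW// fg.
- by move=> x _; rewrite lee_fin.
- exact/measurable_EFinP.
- by move=> x Ax; rewrite lee_fin subr_ge0 ltW// fg.
- by apply/measurable_EFinP; exact: measurable_funB.
Qed.

End measure_facts.

(** * Measurability of the entropies and of the support *)

Section measurable_functionals.
Context d {W : measurableType d} {R : realType} {M : nat}.
Implicit Types f g : W -> R.

Lemma measurable_lt_set f g : measurable_fun setT f -> measurable_fun setT g ->
  measurable [set y | f y < g y].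
Proof.
move=> mf mg; rewrite -[X in measurable X]setTI.
exact: (measurable_fun_ltr mf mg measurableT (Y := [set true])).
Qed.

Lemma measurable_bigmin (I : Type) (r : seq I) (h : I -> W -> R) f :
  measurable_fun setT f -> (forall i, measurable_fun setT (h i)) ->
  measurable_fun setT (fun y => \big[Num.min/f y]_(i <- r) h i y).
Proof.
move=> mf mh; elim: r => [|i r IH]; first by under eq_fun do rewrite big_nil.
by under eq_fun do rewrite big_cons; exact: measurable_minr.
Qed.

Variable p : W -> 'I_M -> R.
Hypothesis mp : forall i, measurable_fun setT (p^~ i).

Lemma measurable_mean_rank (s : 'S_M) :
  measurable_fun setT (fun y => mean_rank (p y) s).
Proof. by apply: measurable_sum => i; exact: measurable_funM. Qed.

Lemma measurable_guessing_entropy :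
  measurable_fun setT (fun y => guessing_entropy (p y)).
Proof. by apply: measurable_bigmin => *; exact: measurable_mean_rank. Qed.

Lemma measurable_alpha_norm a : measurable_fun setT (fun y => alpha_norm a (p y)).
Proof.
apply: (measurableT_comp (measurable_powR _)).
by apply: measurable_sum => i; apply: (measurableT_comp (measurable_powR _)).
Qed.

Lemma measurable_shannon_entropy b :
  measurable_fun setT (fun y => shannon_entropy b (p y)).
Proof.
apply: measurable_funN; apply: measurable_sum => i; apply: measurable_funM => //.
by apply: measurable_funM => //; exact: (measurableT_comp (@measurable_ln R)).
Qed.

Lemma measurable_support_fiber (S : {set 'I_M}) :
  measurable ((fun y => [set i | 0 < p y i]%SET) @^-1` [set S]).
Proof.
have -> : (fun y => [set i | 0 < p y i]%SET) @^-1` [set S] =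
    \bigcap_(i in [set: 'I_M]) [set y | (0 < p y i) = (i \in S)].
  apply/seteqP; split => y /=.
    by move=> <- i _ /=; rewrite inE.
  by move=> yS; apply/setP => i; rewrite inE; exact: (yS i I).
apply: fin_bigcap_measurable => [|i _]; first exact: finite_finset.
rewrite -[X in measurable X]setTI.
by apply: (measurable_fun_ltr (f := fun=> 0) (g := p^~ i) _ _ measurableT
  (Y := [set (i \in S)])).
Qed.

End measurable_functionals.

(** * The posterior in the random probing model *)

Section random_probing.
Context (R : realType) (M : nat) (d dZ dV : measure_display).
Context (T : measurableType d) (P : probability T R).
Context (U : measurableType dZ) (V : measurableType dV).
Variables (K : T -> 'I_M) (Z : {RV P >-> U}) (f : U -> 'I_M -> V).
Variables (Y : {RV P >-> (U * V)%type}) (p : U * V -> 'I_M -> R).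
Hypotheses (hK : uniform_RV P K) (hZK : independent_RVs Z K).
Hypothesis hf : forall k : 'I_M, measurable_fun setT (f^~ k).
Hypothesis hY : forall w : T, Y w = (Z w, f (Z w) (K w)).
Hypothesis hp : conditional_pmf K Y p.

Let nu := distribution P Y.
(** When [K = i], the observation lies in [B] exactly when [Z] lies in [probe i B]. *)
Let probe i (B : set (U * V)) : set U := (fun z => (z, f z i)) @^-1` B.

Let measurable_probe i B : measurable B -> measurable (probe i B).
Proof.
move=> mB; rewrite /probe -[X in measurable X]setTI.
exact: (measurable_fun_pair (@measurable_id _ _ setT) (hf i)).
Qed.

(** Both sides equal the probability that [K = i] and [Y] lies in [B]; independence and uniformity
    factor it. *)
Let integral_cpmf i B : measurable B ->
  (\int[nu]_(y in B) (p y i)%:E = P (Z @^-1` probe i B) * (M%:R^-1)%:E)%E.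
Proof.
move=> mB; rewrite -(cpmf_joint hp)// -(hK i) -hZK; last exact: measurable_probe.
congr (P _); apply/seteqP; split => w /= [].
  by move=> Kw; rewrite hY Kw.
by move=> + Kw; rewrite hY Kw.
Qed.

Let p_le1 y i : p y i <= 1.
Proof.
rewrite -(cpmf_sum1 hp y) (bigD1 i)//= lerDl sumr_ge0// => j _.
exact: (cpmf_ge0 hp).
Qed.

(* On [A := {0 < p_j < p_i}], restricting the first coordinate to the states [z]
   with [(z, f_z j)] in [A] does not change the [K = j] mass, and does not leave
   more [K = i] mass than that.  No measurability of [f_z i = f_z j] (which may
   fail for a general [V]) is needed. *)
Lemma cpmf_lt_null i j : nu [set y | 0 < p y j /\ p y j < p y i] = 0%E.
Proof.
have mp k := cpmf_measurable hp k.
set A := [set y | _].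
have mA : measurable A.
  by apply: measurableI; apply: measurable_lt_set => //; exact: measurable_cst.
have mpE B : measurable_fun B (fun y => (p y j)%:E).
  by apply/measurable_EFinP; exact: measurable_funTS.
pose C := probe j A; pose B := A `&` (C `*` setT).
have mC : measurable C by exact: measurable_probe.
have mB : measurable B by apply: measurableI => //; exact: measurableX.
have CB : probe j B = C by apply/seteqP; split => z //= [].
(* On [B], [p_j < p_i]; yet [probe i B] is contained in [C = probe j B], so [p_i] has no larger
   integral than [p_j]. *)
have B0 : nu B = 0%E.
  apply: (@integral_le_lt_null _ _ _ _ _ (p^~ j) (p^~ i)) => //.
  - by move=> y; exact: (cpmf_ge0 hp).
  - by move=> y [[]].
  rewrite !integral_cpmf// CB lee_wpmul2r ?lee_fin ?invr_ge0//.
  apply: le_measure; rewrite ?inE; last by move=> w [_ []].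
  - rewrite -[X in measurable X]setTI; apply: measurable_funP => //.
    exact: measurable_probe.
  - by rewrite -[X in measurable X]setTI; exact: measurable_funP.
(* [A] and [B] have the same [j]-probe, so [p_j], positive on [A], integrates over [A] as over the
   null set [B]. *)
apply: (@ge0_integral0_null _ _ _ _ _ (fun y => (p y j)%:E)) => //.
  by move=> y [].
by rewrite integral_cpmf// -/C -CB -integral_cpmf// null_set_integral.
Qed.

Lemma cpmf_ae_uniform_on : {ae nu, forall y,
  p y = uniform_on [set i | 0 < p y i]%SET /\
  [set i | 0 < p y i]%SET != finset.set0}.
Proof.
have ltN i j : {ae nu, forall y, 0 < p y j -> ~ p y j < p y i}.
  exists [set y | 0 < p y j /\ p y j < p y i]; split.
  - by apply: measurableI; apply: measurable_lt_set => //;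
      try exact: (cpmf_measurable hp); exact: measurable_cst.
  - exact: cpmf_lt_null.
  - by move=> y /= /not_implyP[? /contrapT].
have : {ae nu, forall y, forall i j, 0 < p y j -> ~ p y j < p y i}.
  by apply: filter_forall => i; apply: filter_forall => j; exact: ltN.
apply: filterS => y; apply: pmf_uniform_on => [i|]; first exact: (cpmf_ge0 hp).
exact: (cpmf_sum1 hp).
Qed.

(** The law of the support of the posterior. *)
Let q (S : {set 'I_M}) : R :=
  fine (nu ((fun y => [set i | 0 < p y i]%SET) @^-1` [set S])).

Let expectation_cpmf (F : ('I_M -> R) -> R) (g : R -> R) :
  measurable_fun setT (fun y => F (p y)) ->
  (forall S : {set 'I_M}, S != finset.set0 -> F (uniform_on S) = g #|S|%:R) ->
  fine 'E_nu[fun y => F (p y)] = \sum_S q S * g #|S|%:R.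
Proof.
move=> mF Fg; apply: (expectation_fin_comp (c := fun S : {set 'I_M} => g #|S|%:R)) => //.
  by move=> S; apply: measurable_support_fiber; exact: (cpmf_measurable hp).
apply: filterS cpmf_ae_uniform_on => y [+ S0].
by move: S0; set S := finset _ => S0 ->; exact: Fg.
Qed.

(** This hides the measure theory: the remaining argument concerns one finite weighted sum over
    supports. *)
Lemma support_size_law : exists w : {set 'I_M} -> R,
  [/\ forall S, 0 <= w S, \sum_S w S = 1,
      forall S, w S != 0 -> 1 <= (#|S|%:R : R) <= M%:R &
   [/\ cond_guessing_entropy Y p = \sum_S w S * ((1 + #|S|%:R) / 2),
      forall b, cond_shannon_entropy Y b p = \sum_S w S * (ln #|S|%:R / ln b) &
      forall b a, 0 < a -> cond_renyi_arimoto_entropy Y b a p =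
        - (a / (a - 1)) * logb b (\sum_S w S * #|S|%:R `^ ((1 - a) / a))]].
Proof.
have mp := cpmf_measurable hp.
exists q; split.
- by move=> S; rewrite fine_ge0.
(* The total weight is the expectation of the constant functional [1]. *)
- have := expectation_cpmf (F := fun=> 1) (g := fun=> 1)
    (@measurable_cst _ _ _ _ _ _) (fun _ _ => erefl).
  by rewrite expectation_cst/= => ->; apply: eq_bigr => S _; rewrite mulr1.
- move=> S qS; rewrite ler1n ler_nat -[X in (_ && (_ <= X)%N)]card_ord max_card andbT card_gt0.
  (* An empty support would make the pmf sum to [0], so its fibre is empty and has weight zero. *)
  apply: contraNneq qS => ->; rewrite /q /nu (_ : _ @^-1` _ = set0) ?measure0 ?eqxx//.
    apply/seteqP; split => // y /= y0.
  have : \sum_(i < M) p y i = 0.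
    apply: big1 => i _; apply/eqP; rewrite eq_le (cpmf_ge0 hp) andbT leNgt.
    by apply/negP => pi; have := finset.in_set0 i; rewrite -y0 inE pi.
  by rewrite (cpmf_sum1 hp) => /eqP; rewrite oner_eq0.
- split => [|b|b a a0].
  + apply: (expectation_cpmf (g := fun x => (1 + x) / 2)).
      exact: measurable_guessing_entropy.
    exact: guessing_entropy_uniform_on.
  + apply: (expectation_cpmf (g := fun x => ln x / ln b)).
      exact: measurable_shannon_entropy.
    exact: shannon_entropy_uniform_on.
  + congr (_ * logb b _).
    apply: (expectation_cpmf (g := fun x => x `^ ((1 - a) / a))).
      exact: measurable_alpha_norm.
    by move=> S; exact: alpha_norm_uniform_on.
Qed.

End random_probing.

(** * Elimination of the base [b], and the final bounds *)

Lemma expb_mul_logb (R : realType) (b c x : R) : 1 < b -> 0 < x ->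
  expb b (c * logb b x) = x `^ c.
Proof.
move=> b1 x0; have b0 : 0 < b by apply: lt_trans b1.
have lnb : ln b != 0 by rewrite gt_eqF// ln_gt0.
by rewrite /expb /powR !gt_eqF// /logb -mulrA divfK.
Qed.

Theorem theorem4 (R : realType) (b : R) (hb : 1 < b)
    (M : nat) (hM : (2 <= M)%N)
    (d dZ dV : measure_display) (T : measurableType d)
    (P : probability T R)
    (U : measurableType dZ) (V : measurableType dV)
    (K : T -> 'I_M) (hKm : discrete_RV K) (hK : uniform_RV P K)
    (Z : {RV P >-> U}) (hZK : independent_RVs Z K)
    (f : U -> 'I_M -> V) (hf : forall k : 'I_M, measurable_fun setT (f^~ k))
    (Y : {RV P >-> (U * V)%type}) (hY : forall w : T, Y w = (Z w, f (Z w) (K w)))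
    (p : U * V -> 'I_M -> R) (hp : conditional_pmf K Y p) :
  let G := cond_guessing_entropy Y p in
  let H := cond_shannon_entropy Y b p in
  let Ha a := cond_renyi_arimoto_entropy Y b a p in
  let bound a := 1 + (M%:R - 1) / 2 *
    ((expb b ((1 - a) / a * Ha a) - 1) / (M%:R `^ ((1 - a) / a) - 1)) in
  (forall a : R, 0 < a -> a != 1 ->
     (2^-1 <= a -> (1 + expb b (Ha a)) / 2 <= G /\ G <= bound a) /\
     (a <= 2^-1 -> bound a <= G /\ G <= (1 + expb b (Ha a)) / 2)) /\
  ((1 + expb b H) / 2 <= G /\ G <= 1 + (M%:R - 1) / 2 * (H / logb b M%:R)).
Proof.
move=> G H Ha bound.
have [w [w0 w1 wM [GE HE HaE]]] := support_size_law hK hZK hf hY hp.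
have M1 : 1 < M%:R :> R by rewrite ltr1n.
set m := \sum_S w S * #|S|%:R.
have {}GE : G = (1 + m) / 2.
  rewrite /G GE (eq_bigr (fun S => w S * (2^-1 + 2^-1 * #|S|%:R))) => [|S _].
    by rewrite sum_affine// -/m; field.
  by congr (_ * _); field.
split=> [a a0 a1|].
  (* [2^-1 <= a] becomes [s <= 1], the concave case, and [a <= 2^-1] becomes [1 <= s]; [a != 1]
     gives [s != 0]. *)
  pose s := (1 - a) / a.
  have s0 : s != 0 by rewrite mulf_eq0 negb_or subr_eq0 eq_sym a1 invr_eq0 gt_eqF.
  pose A := \sum_S w S * #|S|%:R `^ s.
  have A0 : 0 < A := mean_powR_gt0 w0 w1 M1 wM s.
  have HaA : Ha a = s^-1 * logb b A.
    rewrite /Ha HaE// -/s -/A; congr (_ * _); rewrite /s.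
    by field; rewrite gt_eqF//= !subr_eq0 a1 eq_sym a1.
  have -> : expb b (Ha a) = A `^ s^-1 by rewrite HaA expb_mul_logb.
  have boundE : bound a = 1 + (M%:R - 1) * ((A - 1) / (M%:R `^ s - 1)) / 2.
    rewrite /bound HaA -/s mulVKf// -[logb b A]mul1r expb_mul_logb//.
    by rewrite powRr1 ?ltW// mulrAC.
  rewrite boundE GE; split => ha.
    have s1 : s <= 1 by rewrite ler_pdivrMr// mul1r; lra.
    have [] := power_mean_le w0 w1 M1 wM s0 s1; rewrite -/A -/m.
    by move: (_ * (_ / _)) (A `^ _) => u v; lra.
  have s1 : 1 <= s by rewrite ler_pdivlMr// mul1r; lra.
  have [] := power_mean_ge w0 w1 M1 wM s0 s1; rewrite -/A -/m.
  by move: (_ * (_ / _)) (A `^ _) => u v; lra.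
(* The case [a = 1] is [s = 0], with the geometric mean in place of the power mean. *)
pose L := \sum_S w S * ln #|S|%:R.
have HL : H = L / ln b.
  by rewrite /H HE mulr_suml; apply: eq_bigr => S _; rewrite mulrA.
have lnb : ln b != 0 by rewrite gt_eqF// ln_gt0.
have -> : expb b H = expR L.
  by rewrite HL /expb /powR gt_eqF ?divfK// (lt_trans ltr01).
have -> : H / logb b M%:R = L / ln M%:R.
  by rewrite HL /logb; field; rewrite lnb gt_eqF// ln_gt0.
have [] := geometric_mean_le w0 w1 M1 wM; rewrite -/L -/m GE mulrAC.
by move: (_ * (_ / _)) (expR _) => u v; lra.
Qed.
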